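(* Let $P_n$ be a path on $n\ge 1$ vertices. Then $vcfc(P_n)=\lceil\log_2(n+1)\rceil$.
   Context: Vertex-colorings are arbitrary, not necessarily proper. A path in a vertex-colored graph is called conflict-free if there is a color used on exactly one of its vertices. A vertex-colored graph is conflict-free vertex-connected if any two vertices of the graph are connected by a conflict-free path. For a connected graph $G$, the conflict-free vertex-connection number $vcfc(G)$ is the smallest number of colors needed in a vertex-coloring of $G$ that makes $G$ conflict-free vertex-connected. *)

(* Defs.v *)
From mathcomp Require Import all_boot.
From mathcomp Require Import boolp.

Set Implicit Arguments.
Unset Strict Implicit.
Unset Printing Implicit Defensive.

Record sgraph := SGraph {
  vertex :> finType;
  adj : rel vertex;
  adj_sym : symmetric adj;
  adj_irrefl : irreflexive adj }.

Definition connected_graph (G : sgraph) : Prop :=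
  forall x y : G, connect (@adj G) x y.

(* The vertices of the path, in order, are x :: p, and they are pairwise
   distinct. *)
Definition is_path (G : sgraph) (x y : G) (p : seq G) : bool :=
  [&& path (@adj G) x p, last x p == y & uniq (x :: p)].

Definition conflict_free (G : sgraph) (C : finType) (f : G -> C) (s : seq G) :
    Prop :=
  exists c : C, count (fun v => f v == c) s = 1.

(* The case x = y is harmless: the one-vertex path is conflict-free. *)
Definition conflict_free_vertex_connected (G : sgraph) (C : finType)
    (f : G -> C) : Prop :=
  forall x y : G, exists2 p : seq G, is_path x y p & conflict_free f (x :: p).

Definition vcf_colorable (G : sgraph) (k : nat) : Prop :=
  exists f : G -> 'I_k, conflict_free_vertex_connected f.

Lemma vcf_colorable_exists (G : sgraph) :
  connected_graph G -> exists k : nat, `[< vcf_colorable G k >].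
Proof.
move=> connG; exists #|G|; apply/asboolP; exists enum_rank => x y.
have /connectP[p xp ->] := connG x y.
have [q xq uq _] := shortenP xp.
exists q; first by rewrite /is_path xq uq eqxx.
exists (enum_rank x); rewrite (eq_count (a2 := pred1 x)); last first.
  by move=> v /=; rewrite (inj_eq enum_rank_inj).
by rewrite (count_uniq_mem _ uq) mem_head.
Qed.

Definition vcfc (G : sgraph) (connG : connected_graph G) : nat :=
  ex_minn (vcf_colorable_exists connG).
Arguments vcfc : clear implicits.

Definition path_adj (n : nat) : rel 'I_n :=
  fun i j => (i.+1 == j :> nat) || (j.+1 == i :> nat).

Lemma path_adj_sym (n : nat) : symmetric (@path_adj n).
Proof. by move=> i j; rewrite /path_adj orbC. Qed.

Lemma path_adj_irrefl (n : nat) : irreflexive (@path_adj n).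
Proof. by move=> i; rewrite /path_adj orbb eqn_leq ltnn. Qed.

Definition path_graph (n : nat) : sgraph :=
  SGraph (@path_adj_sym n) (@path_adj_irrefl n).

Lemma path_graph_connected (n : nat) : connected_graph (path_graph n).
Proof.
case: n => [|n]; first by case.
have conn0 (k : nat) (ltk : k < n.+1) :
    connect (@path_adj n.+1) ord0 (Ordinal ltk).
  elim: k ltk => [|k IHk] ltk.
    by rewrite (_ : Ordinal ltk = ord0) ?connect0 //; apply: val_inj.
  apply: connect_trans (IHk (ltnW ltk)) (connect1 _).
  by rewrite /path_adj /= eqxx.
move=> [i lti] [j ltj]; apply: connect_trans (conn0 j ltj).
by rewrite (sym_connect_sym (@path_adj_sym n.+1)); apply: conn0.
Qed.

(* Main.v *)
Require Import Defs.
From mathcomp Require Import all_boot.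
From mathcomp Require Import boolp zify.

(** The only simple path between two vertices of [P_n] is the interval between
    them, so the question is about colorings of [1, .., n] in which every
    interval has a color occurring exactly once. For the upper bound, color
    [v] by its 2-adic valuation: the maximal valuation in an interval is
    attained only once, as between two odd multiples of [2 ^ e] lies an even
    one. For the lower bound, the vertex of unique color in the whole path
    splits it into two paths avoiding that color, so by induction [k] colors
    suffice for at most [2 * (2 ^ (k - 1) - 1) + 1 = 2 ^ k - 1] vertices. *)

Lemma conflict_freeP (G : sgraph) (C : finType) (f : G -> C) (s : seq G) :
  uniq s ->
  conflict_free f s <->
  exists2 u, u \in s & {in s, forall v, f v = f u -> v = u}.
Proof.
move=> uniq_s; split=> [[c]|[u us uu]].
  rewrite -size_filter; case E: (filter _ s) => [|u [|? ?]] //= _.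
  have [/eqP fu us] : f u == c /\ u \in s.
    by apply/andP; rewrite -(mem_filter (fun v => f v == c)) E mem_head.
  exists u => // v vs fv; apply/eqP; rewrite -mem_seq1 -E mem_filter vs andbT.
  by rewrite fv fu.
exists (f u); rewrite (eq_in_count (a2 := pred1 u)).
  by rewrite count_uniq_mem // us.
by move=> v vs /=; apply/eqP/eqP => [/uu->|->].
Qed.

(** Induction on [p]: the rest of the path fills the interval from the neighbor [z] of [x] to [y].
    It avoids [x], so [z] lies on the side of [y], and adding [x] lengthens the interval by one. *)
Lemma mem_path_graph_path (n : nat) (x y : path_graph n) p (v : path_graph n) :
  is_path x y p ->
  (v \in x :: p) =
  (minn (x : 'I_n) (y : 'I_n) <= (v : 'I_n) <= maxn (x : 'I_n) (y : 'I_n)).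
Proof.
move=> /and3P[]; elim: p x v => [|z q IHq] x v.
  move=> _ /= /eqP <- _; rewrite mem_seq1 -(inj_eq val_inj) /=; lia.
rewrite [path _ _ _]/= [last _ _]/= [uniq _]cons_uniq.
move=> /andP[xz zq] zy /andP[xNzq uzq].
rewrite in_cons (IHq z v) //; move: xNzq; rewrite (IHq z x) // => xNzq.
rewrite -(inj_eq val_inj) /=.
move: xz; rewrite /path_adj /=; lia.
Qed.

Lemma path_graph_cfvcP (n : nat) (C : finType) (f : path_graph n -> C) :
  conflict_free_vertex_connected f <->
  forall x y : 'I_n, x <= y ->
  exists2 u : 'I_n, x <= u <= y &
    forall v : 'I_n, x <= v <= y -> f v = f u -> v = u.
Proof.
split=> [cf x y le_xy|H x y].
  have [p xpy] := cf x y.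
  have /and3P[_ _ up] := xpy.
  move=> /(conflict_freeP _ _ f _ up)[u].
  rewrite (mem_path_graph_path _ _ _ _ u xpy) => xuy uu; exists u; first lia.
  move=> v xvy; apply: uu; rewrite (mem_path_graph_path _ _ _ _ v xpy); lia.
have /connectP[p0 xp0 y_def] := @path_graph_connected n x y.
have [p xpy] : exists p, is_path x y p.
  rewrite y_def; have [q xq uq _] := shortenP xp0.
  by exists q; rewrite /is_path xq uq eqxx.
exists p => //; have /and3P[_ _ up] := xpy.
apply/conflict_freeP => //.
have [u xuy uu] : exists2 u : 'I_n,
    minn (x : 'I_n) (y : 'I_n) <= u <= maxn (x : 'I_n) (y : 'I_n) &
    forall v : 'I_n, minn (x : 'I_n) (y : 'I_n) <= v
      <= maxn (x : 'I_n) (y : 'I_n) -> f v = f u -> v = u.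
  case: (leqP (x : 'I_n) (y : 'I_n)) => [|/ltnW] /H //.
exists u; first by rewrite (mem_path_graph_path _ _ _ _ u xpy).
by move=> v; rewrite (mem_path_graph_path _ _ _ _ v xpy); apply: uu.
Qed.

(** Confining the colors to a set [A] lets the induction pass to a subinterval and to [A] minus one
    color. *)
Lemma interval_lt_expn_colors (C : finType) (g : nat -> C) (A : {set C}) a b :
  (forall i, a <= i < b -> g i \in A) ->
  (forall i j, a <= i <= j -> j < b ->
     exists2 k, i <= k <= j & forall l, i <= l <= j -> g l = g k -> l = k) ->
  b - a < 2 ^ #|A|.
Proof.
elim: {A}#|A| {-2}A (erefl #|A|) a b => [|m IHm] A cardA a b gA guniq;
  (have [|lt_ab] := leqP b a;
   first by rewrite -subn_eq0 => /eqP->; rewrite expn_gt0).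
  by have := gA a; rewrite leqnn lt_ab (cards0_eq cardA) inE => /(_ isT).
have [||k akb kuniq] := guniq a b.-1; [lia | lia |].
have kA : g k \in A by apply: gA; lia.
have cardA' : #|A :\ g k| = m by have := cardsD1 (g k) A; rewrite kA; lia.
(* On the whole interval [g k] occurs only at [k], so a part without [k] has its colors in
   [A :\ g k]. *)
have half c d : a <= c -> d <= b -> ~~ (c <= k < d) -> d - c < 2 ^ m.
  move=> ac db kNcd; rewrite -cardA'; apply: (IHm _ cardA') => [i cid|i j cij jd].
    rewrite !inE gA ?andbT; last lia.
    by apply/eqP => /kuniq ik; move: kNcd; rewrite -ik; lia.
  by apply: guniq; lia.
have := half a k; have := half k.+1 b; rewrite cardA expnS; lia.
Qed.

Lemma logn2_gt_between x y :
  0 < x < y -> logn 2 x = logn 2 y ->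
  exists2 z, x < z < y & logn 2 x < logn 2 z.
Proof.
move=> /andP[x_gt0 xy] e_xy; have y_gt0 := ltn_trans x_gt0 xy.
have [a aodd x_def] := pfactor_coprime (isT : prime 2) x_gt0.
have [b bodd y_def] := pfactor_coprime (isT : prime 2) y_gt0.
move: y_def; rewrite -e_xy; move: x_def; move: (logn 2 x) => e x_def y_def.
rewrite !coprime2n in aodd bodd.
have e_gt0 : 0 < 2 ^ e by rewrite expn_gt0.
have lt_ab : a < b by move: xy; rewrite x_def y_def ltn_pmul2r.
have a1_ltb : a.+1 < b.
  rewrite ltn_neqAle lt_ab andbT.
  by apply: contraTneq bodd => <-; rewrite /= aodd.
(* As [a] is odd, [a.+1] is even, which gives at least one more factor 2. *)
exists (a.+1 * 2 ^ e); first by rewrite x_def y_def !ltn_pmul2r // ltnSn.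
rewrite -pfactor_dvdn ?muln_gt0 // expnS dvdn_pmul2r // dvdn2 /=.
by rewrite negbK.
Qed.

Lemma interval_logn2_max_uniq x y :
  0 < x <= y ->
  exists2 u, x <= u <= y &
    forall v, x <= v <= y -> logn 2 v = logn 2 u -> v = u.
Proof.
move=> /andP[x_gt0 le_xy].
have x_ord : x < y.+1 by [].
pose i0 : 'I_y.+1 := Ordinal x_ord.
have [|u xu umax] := @arg_maxnP _ i0 (fun i => x <= i) (fun i => logn 2 i).
  exact: leqnn.
exists u; first by rewrite xu -ltnS ltn_ord.
move=> v xvy lv.
have nogt z : x <= z <= y -> logn 2 z <= logn 2 u.
  by move=> /andP[xz]; rewrite -ltnS => zy; exact: umax (Ordinal zy) xz.
have uy := ltn_ord u.
(* If [v] and [u] differed, a number between them would exceed the maximal valuation. *)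
case: (ltngtP v u) => // [vu|uv].
  have [||z zb] := logn2_gt_between v u; [lia | by [] |].
  by rewrite lv ltnNge nogt //; lia.
have [||z zb] := logn2_gt_between u v; [lia | by [] |].
by rewrite ltnNge nogt //; lia.
Qed.

Lemma path_graph_colorable (n k : nat) :
  n < 2 ^ k -> vcf_colorable (path_graph n) k.
Proof.
move=> n_lt.
(* Vertices are numbered from 0, hence the shift to [v.+1]. The power of 2 dividing it is at most
   [n]. *)
have logn_lt (v : 'I_n) : logn 2 v.+1 < k.
  rewrite -(@ltn_exp2l 2) //; apply: leq_ltn_trans n_lt.
  apply: leq_trans (ltn_ord v).
  by apply: dvdn_leq => //; exact: pfactor_dvdnn.
exists (fun v : 'I_n => Ordinal (logn_lt v)).
apply/path_graph_cfvcP => x y le_xy.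
have [|u xuy uu] := interval_logn2_max_uniq x.+1 y.+1; first lia.
have ltun : u.-1 < n by have := ltn_ord y; lia.
have uE : u.-1.+1 = u by lia.
exists (Ordinal ltun); first by rewrite /=; lia.
move=> v xvy [] /=; rewrite uE => /uu vu.
by apply: val_inj => /=; rewrite -vu //; lia.
Qed.

Lemma path_graph_colorable_lt (n k : nat) :
  vcf_colorable (path_graph n) k -> n < 2 ^ k.
Proof.
case: n => [|n]; first by rewrite expn_gt0.
case=> f /path_graph_cfvcP cf.
rewrite -[n.+1]subn0 -[k]card_ord -cardsT.
(* [inord] extends [f] to [nat]; its default value matters only outside the interval considered. *)
apply: (interval_lt_expn_colors _ (fun i => f (inord i))) => [i _|i j ij jn].
  by rewrite inE.
have [|u] := cf (inord i) (inord j); first by rewrite !inordK //; lia.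
rewrite !inordK //; last lia.
move=> iuj uu; exists u => // l ilj; rewrite inord_val => /uu.
rewrite inordK //; last lia.
by move=> <- //; rewrite inordK //; lia.
Qed.

Theorem theorem1 (n : nat) (hn : 1 <= n) :
  vcfc (path_graph n) (@path_graph_connected n) = up_log 2 (n + 1).
Proof.
rewrite /vcfc addn1; case: ex_minnP => m /asboolP colm minm.
(* [n < 2 ^ k] is [n.+1 <= 2 ^ k], and [up_log 2 n.+1] is the least such [k]. *)
apply/eqP; rewrite eqn_leq minm /=; last first.
  by apply/asboolP/path_graph_colorable/up_logP.
exact/up_log_min/path_graph_colorable_lt.
Qed.
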